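(* Let $P$ be a finite poset, $k\ge1$, and fix a linear extension $(x_1,\dots,x_p)$ of $P$. Let $w=w_{x_1}\circ w_{x_2}\circ\cdots\circ w_{x_p}$ be whirling on $\mathcal{F}_k(P)$. Then there is a bijection $\phi:\mathcal{F}_k(P)\to\mathcal{J}(P\times[k])$ such that $\phi\circ w=\rho\circ\phi$, where $\rho$ is rowmotion on $\mathcal{J}(P\times[k])$.
   Context: A $k$-bounded $P$-partition is a function $f:P\to\{0,1,\dots,k\}$ such that $x\le_P y$ implies $f(x)\ge f(y)$; $\mathcal{F}_k(P)$ is the set of these. For $x\in P$, the whirl $w_x:\mathcal{F}_k(P)\to\mathcal{F}_k(P)$ repeatedly adds $1$ modulo $k+1$ to the value $f(x)$ (leaving other values unchanged) until the result lies in $\mathcal{F}_k(P)$; that result is $w_x(f)$. A linear extension is a listing $x_1,\dots,x_p$ of all elements of $P$ such that $x_i<_P x_j$ implies $i<j$. $[k]=\{1<\dots<k\}$, $P\times[k]$ has the product order, $\mathcal{J}(Q)$ is the set of order ideals of $Q$, and rowmotion $\rho$ sends $I$ to the order ideal generated by the minimal elements of $Q\setminus I$. *)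

(* Defs.v *)
From HB Require Import structures.
From mathcomp Require Import all_boot all_order.

Set Implicit Arguments.
Unset Strict Implicit.
Unset Printing Implicit Defensive.

Import Order.Theory.
Local Open Scope order_scope.

Section BoundedPPartitions.
Variables (d : Order.disp_t) (P : finPOrderType d) (k : nat).

Definition is_Ppartition (f : {ffun P -> 'I_k.+1}) : bool :=
  [forall x, forall y, (x <= y) ==> (f y <= f x)%N].

Record Ppartition :=
  PPartition { Ppart_fun :> {ffun P -> 'I_k.+1}; _ : is_Ppartition Ppart_fun }.

HB.instance Definition _ := [isSub for Ppart_fun].
HB.instance Definition _ := [Finite of Ppartition by <:].

(* [ordS] is the successor modulo k+1 on ['I_k.+1]. *)
Definition incr_at (x : P) (f : {ffun P -> 'I_k.+1}) : {ffun P -> 'I_k.+1} :=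
  [ffun y => if y == x then ordS (f y) else f y].

Lemma iter_incr_atE x f n y :
  iter n (incr_at x) f y = if y == x then iter n (@ordS k.+1) (f y) else f y.
Proof.
elim: n => [|n IHn] /=; first by case: (y == x).
by rewrite ffunE IHn; case: (y == x).
Qed.

Lemma val_iter_ordS n (i : 'I_k.+1) : iter n (@ordS k.+1) i = ((i + n) %% k.+1)%N :> nat.
Proof.
elim: n => [|n IHn] /=; first by rewrite addn0 modn_small.
by rewrite IHn -addn1 modnDml addn1 addnS.
Qed.

Lemma iter_incr_at_period x f : iter k.+1 (incr_at x) f = f.
Proof.
apply/ffunP => y; rewrite iter_incr_atE; case: (y == x) => //.
by apply/val_inj; rewrite [LHS]val_iter_ordS modnDr modn_small.
Qed.

Lemma whirl_stops (x : P) (f : Ppartition) :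
  exists n, (0 < n)%N && is_Ppartition (iter n (incr_at x) f).
Proof. by exists k.+1; rewrite iter_incr_at_period; case: f. Qed.

(* The number of increments is positive: one is always performed before the
   first membership test. *)
Lemma whirl_subproof (x : P) (f : Ppartition) :
  is_Ppartition (iter (ex_minn (whirl_stops x f)) (incr_at x) f).
Proof. by case: ex_minnP => n /andP[]. Qed.

Definition whirl (x : P) (f : Ppartition) : Ppartition :=
  PPartition (whirl_subproof x f).

Definition linear_extension (s : seq P) : Prop :=
  [/\ uniq s, (forall x, x \in s)
    & forall x y, x < y -> (index x s < index y s)%N].

(* For s = [:: x_1; ...; x_p], this is w_{x_1} (... (w_{x_p} f)). *)
Definition whirling (s : seq P) (f : Ppartition) : Ppartition :=
  foldr whirl f s.

End BoundedPPartitions.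

Section Rowmotion.
Variables (d : Order.disp_t) (Q : finPOrderType d).

Definition is_order_ideal (I : {set Q}) : bool :=
  [forall x, forall y, (x <= y) && (y \in I) ==> (x \in I)].

Record order_ideal :=
  OrderIdeal { ideal_set :> {set Q}; _ : is_order_ideal ideal_set }.

HB.instance Definition _ := [isSub for ideal_set].
HB.instance Definition _ := [Finite of order_ideal by <:].

Definition minimal_elements (A : {set Q}) : {set Q} :=
  [set x in A | [forall y in A, ~~ (y < x)]].

Definition generated_ideal_set (A : {set Q}) : {set Q} :=
  [set x | [exists y in A, x <= y]].

Lemma generated_ideal_subproof A : is_order_ideal (generated_ideal_set A).
Proof.
apply/forallP => x; apply/forallP => y; apply/implyP => /andP[le_xy].
rewrite !inE => /exists_inP[z Az le_yz]; apply/exists_inP.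
by exists z => //; apply: le_trans le_yz.
Qed.

Definition generated_ideal (A : {set Q}) : order_ideal :=
  OrderIdeal (generated_ideal_subproof A).

Definition rowmotion (I : order_ideal) : order_ideal :=
  generated_ideal (minimal_elements (~: I)).

End Rowmotion.

(* Main.v *)
Require Import Defs.
From HB Require Import structures.
From mathcomp Require Import all_boot all_order.
From mathcomp Require Import zify.

Import Order.Theory.

(** The bijection sends [f] to the ideal of all [(x, i)] with [i < f x] (the
    indices [i] run over [0, ..., k-1]).  Call [x] raisable in [f] when [f x] may
    be increased by one while all other values are kept.  Whirling at [x]
    increases a raisable value by one and resets any other value to the maximum
    of the values above [x].  When the whirls are performed from top to bottom,
    the elements below [x] are still unwhirled and those above [x] are already
    whirled, so by downward induction [i < w f x] iff [i <= f y] for some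
    raisable [y >= x].  The minimal elements of the complement of the ideal of
    [f] are the pairs [(y, f y)] with [y] raisable, so rowmotion gives the same
    ideal. *)

Set Implicit Arguments.
Unset Strict Implicit.
Unset Printing Implicit Defensive.

Local Open Scope order_scope.

(** * Whirling in terms of raisable elements *)

Section Whirling.
Variables (d : Order.disp_t) (P : finPOrderType d) (k : nat).
Implicit Types (f g : Ppartition P k) (x y z : P) (s : seq P).

Lemma is_PpartitionP (f : {ffun P -> 'I_k.+1}) :
  reflect (forall x y, x < y -> (f y <= f x)%N) (is_Ppartition f).
Proof.
apply: (iffP forallP) => [fP x y /ltW le_xy | fP x].
  by move/forallP/(_ y)/implyP: (fP x); apply.
apply/forallP => y; apply/implyP; rewrite le_eqVlt => /predU1P[-> //|].
exact: fP.
Qed.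

Lemma Ppartition_le f x y : x <= y -> (f y <= f x)%N.
Proof.
rewrite le_eqVlt => /predU1P[-> //|]; apply/is_PpartitionP; exact: valP.
Qed.

Definition raisable f x : bool :=
  (f x < k)%N && [forall z, (z < x) ==> (f x < f z)%N].

Lemma iter_incr_at_Ppartition f x n :
  (forall z, z < x -> ((f x + n) %% k.+1 <= f z)%N) ->
  (forall y, x < y -> (f y <= (f x + n) %% k.+1)%N) ->
  is_Ppartition (iter n (incr_at x) f).
Proof.
move=> lo hi; apply/is_PpartitionP => y z lt_yz; rewrite !iter_incr_atE.
case: (z =P x) lt_yz => [-> | _]; case: (y =P x) => [-> | _] lt_yz.
- by rewrite ltxx in lt_yz.
- by rewrite val_iter_ordS; apply: lo.
- by rewrite val_iter_ordS; apply: hi.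
- exact/Ppartition_le/ltW.
Qed.

Lemma whirl_neq x f y : y != x -> whirl x f y = f y.
Proof. by move=> /negPf nyx; rewrite [LHS]iter_incr_atE nyx. Qed.

(** The new value is described by the numbers [i] strictly below it. A maximum over the values above
    [x] thus becomes an existential, a maximal [x] needs no separate case, and the form matches
    membership in the ideal. *)
Lemma ltn_whirl x f i :
  (i < whirl x f x)%N =
  raisable f x && (i <= f x)%N || [exists y, (x < y) && (i < whirl x f y)%N].
Proof.
have above y : x < y -> whirl x f y = f y.
  by move=> lt_xy; apply: whirl_neq; rewrite gt_eqF.
have below z : z < x -> whirl x f z = f z.
  by move=> lt_zx; apply: whirl_neq; rewrite lt_eqF.
have exlt : [exists y, (x < y) && (i < whirl x f y)%N] -> (i < whirl x f x)%N.
  case/existsP=> y /andP[lt_xy lt_i].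
  exact/(leq_trans lt_i)/Ppartition_le/ltW.
have vE : whirl x f x = ((f x + ex_minn (whirl_stops x f)) %% k.+1)%N :> nat.
  by rewrite [LHS](congr1 val (iter_incr_atE _ _ _ _)) eqxx -val_iter_ordS.
move: vE; case: ex_minnP => n /andP[n_gt0 _] n_min vE.
have lefk := ltn_ord (f x).
have n_le : (n <= k.+1)%N.
  by apply: n_min; rewrite iter_incr_at_period; case: (f).
case: (boolP (raisable f x)) => [/andP[lt_fk /forallP rf] | nrf].
  have fS : ((f x + 1) %% k.+1 = (f x).+1)%N by rewrite addn1 modn_small.
  have n1 : n = 1%N.
    apply/eqP; rewrite eqn_leq n_gt0 andbT; apply: n_min => /=.
    apply: (@iter_incr_at_Ppartition _ _ 1) => [z lt_zx | y lt_xy]; rewrite fS.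
      exact: (implyP (rf z)).
    exact/leqW/Ppartition_le/ltW.
  rewrite andTb vE n1 fS ltnS; case: leqP => //= lt_fi.
  apply/esym/negbTE/negP => /exlt; rewrite vE n1 fS; lia.
(* A larger new value would bound every value below [x] from below, which makes [x] raisable. *)
have le_vf : (whirl x f x <= f x)%N.
  rewrite leqNgt; apply: contra nrf => lt_fv; apply/andP; split.
    by have := ltn_ord (whirl x f x); lia.
  apply/forallP => z; apply/implyP => lt_zx; apply: (leq_trans lt_fv).
  by rewrite -below //; apply/Ppartition_le/ltW.
(* Since [0 < n <= k.+1] and the value has not grown, the increments wrap around exactly once. *)
have {}vE : (whirl x f x + k.+1 = f x + n)%N.
  move: le_vf vE; case: (ltnP (f x + n) k.+1) => [lt_n | ge_n].
    by rewrite modn_small //; lia.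
  rewrite -{1}(subnK ge_n) modnDr modn_small; lia.
rewrite andFb orFb; apply/idP/idP => // lt_iv; apply/contraT; rewrite negb_exists => /forallP ni.
(* Otherwise [i] is an admissible value reached before [whirl x f x]. *)
have iE : ((f x + (k.+1 - f x + i)) %% k.+1 = i)%N.
  have -> : (f x + (k.+1 - f x + i) = i + k.+1)%N by lia.
  by rewrite modnDr modn_small //; lia.
suff : (n <= k.+1 - f x + i)%N by lia.
apply: n_min; apply/andP; split; first lia.
apply: iter_incr_at_Ppartition => [z lt_zx | y lt_xy]; rewrite iE.
  by have := Ppartition_le f (ltW lt_zx); lia.
by move: (ni y); rewrite lt_xy above //= -leqNgt.
Qed.

(** A tail of a linear extension no longer lists all of [P], but the pairwise condition passes to
    tails and so supports induction on [s]. *)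
Lemma linear_extension_pairwise s :
  linear_extension s -> pairwise (fun x y => ~~ (y < x)) s.
Proof.
case: s => // x0 s [us _ ltidx]; apply/(pairwiseP x0) => i j Hi Hj lt_ij.
by apply/negP => /ltidx; rewrite !index_uniq // ltnNge ltnW.
Qed.

Lemma whirling_notin s f x : x \notin s -> whirling s f x = f x.
Proof.
elim: s => //= y s IHs; rewrite inE negb_or => /andP[nxy /IHs <-].
exact: whirl_neq.
Qed.

Lemma ltn_whirling_rec s f x i :
  uniq s -> pairwise (fun x y => ~~ (y < x)) s -> x \in s ->
  (i < whirling s f x)%N =
  raisable f x && (i <= f x)%N ||
    [exists y, (x < y) && (i < whirling s f y)%N].
Proof.
elim: s => //= z s IHs /andP[nzs us] /andP[/allP nlt ps].
(* If [x] is the head, nothing below it occurs in the tail, so raisability at [x] is still that in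
   [f]. Otherwise the head, whirled last, is neither [x] nor above [x], and both sides ignore it. *)
rewrite inE; case: (x =P z) => [-> _ | /eqP nxz /= xs].
  have fz := whirling_notin f nzs.
  have fl y : y < z -> whirling s f y = f y.
    by move=> lt_yz; apply/whirling_notin/negP => /nlt; rewrite lt_yz.
  rewrite ltn_whirl fz; congr (_ && _ || _).
  rewrite /raisable fz; congr (_ && _); apply: eq_forallb => y.
  by case: (boolP (y < z)) => // /fl ->.
rewrite whirl_neq // IHs //; congr (_ || _); apply: eq_existsb => y.
case: (boolP (x < y)) => //= lt_xy; rewrite whirl_neq //.
by apply: contraTneq lt_xy => ->; apply: nlt.
Qed.

Lemma ltn_whirling s f x i : linear_extension s ->
  (i < whirling s f x)%N =
  [exists y, [&& x <= y, raisable f y & (i <= f y)%N]].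
Proof.
move=> sP; have ps := linear_extension_pairwise sP; case: sP => us ins _.
(* Downward induction, by the number of elements strictly above [x]. *)
have [n] := ubnP #|[set y | x < y]|; elim: n x => // n IHn x lt_n.
rewrite ltn_whirling_rec //.
have IH y : x < y -> (i < whirling s f y)%N =
    [exists z, [&& y <= z, raisable f z & (i <= f z)%N]].
  move=> lt_xy; apply: IHn; rewrite ltnS in lt_n; apply: leq_trans lt_n.
  apply/proper_card/properP; split.
    by apply/subsetP => z; rewrite !inE; apply: lt_trans.
  by exists y; rewrite !inE ?ltxx.
apply/orP/existsP => [[rx | /existsP[y /andP[lt_xy]]] | [y /and3P[]]].
- by exists x; rewrite lexx.
- rewrite IH // => /existsP[z /and3P[le_yz rz iz]]; exists z.
  by rewrite rz iz (le_trans (ltW lt_xy) le_yz).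
rewrite le_eqVlt => /predU1P[<- rx ix | lt_xy ry iy].
  by left; rewrite rx.
right; apply/existsP; exists y; rewrite lt_xy IH //.
by apply/existsP; exists y; rewrite lexx ry.
Qed.

End Whirling.

(** * The bijection with order ideals, and rowmotion *)

Section IdealOfPpartition.
Variables (d : Order.disp_t) (P : finPOrderType d) (k : nat).
Let Q : finPOrderType _ := (P *p 'I_k)%type.
Implicit Types (f g : Ppartition P k) (I : order_ideal Q).

Lemma order_ideal_closed I (p q : Q) : p <= q -> q \in ideal_set I -> p \in ideal_set I.
Proof.
case: I => A /= /forallP/(_ p)/forallP/(_ q)/implyP AP le_pq Aq.
by apply: AP; rewrite le_pq.
Qed.

Definition subgraph f : {set Q} := [set p : Q | (p.2 < f p.1)%N].

Lemma subgraph_ideal f : is_order_ideal (subgraph f).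
Proof.
apply/forallP => -[x i]; apply/forallP => -[y j]; apply/implyP.
rewrite !inE leEprod leEord /= => /andP[/andP[le_xy le_ij] lt_j].
exact/(leq_ltn_trans le_ij)/(leq_trans lt_j)/Ppartition_le.
Qed.

Definition ideal_of_Ppartition f : order_ideal Q := OrderIdeal (subgraph_ideal f).

Lemma ideal_of_Ppartition_inj : injective ideal_of_Ppartition.
Proof.
move=> f g /(congr1 (@ideal_set _ _))/setP fg.
suff le_fg h1 h2 : subgraph h1 =i subgraph h2 -> forall x, (h1 x <= h2 x)%N.
  apply/val_inj/ffunP => x; apply/val_inj/anti_leq.
  by rewrite !le_fg // => p; rewrite fg.
move=> h12 x; rewrite leqNgt; apply/negP => lt_h.
(* The smaller value [h2 x] is itself an index, and over [x] it separates the two subgraphs. *)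
have lt_k : (h2 x < k)%N by have := ltn_ord (h1 x); lia.
by have := h12 (x, Ordinal lt_k); rewrite !inE /= lt_h ltnn.
Qed.

(** The fibre of [I] over [x] is an initial segment of ['I_k], so this is its cardinality; an empty
    fibre gets the default 0. *)
Definition ideal_height I (x : P) : nat :=
  \max_(i < k | ((x, i) : Q) \in ideal_set I) i.+1.

Lemma ideal_height_lt I x : (ideal_height I x < k.+1)%N.
Proof. by apply/bigmax_leqP => i _; apply: ltn_ord. Qed.

Lemma ltn_ideal_height I x (i : 'I_k) :
  (i < ideal_height I x)%N = (((x, i) : Q) \in ideal_set I).
Proof.
apply/idP/idP => [|Ii]; last exact: (leq_bigmax_cond (F := fun i : 'I_k => i.+1)).
apply: contraTT => nIi; rewrite -leqNgt; apply/bigmax_leqP => j Ij.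
rewrite ltnNge; apply: contra nIi => le_ij.
by apply: order_ideal_closed Ij; rewrite leEprod /= lexx leEord.
Qed.

Lemma ideal_height_Ppartition I :
  is_Ppartition [ffun x => Ordinal (ideal_height_lt I x)].
Proof.
apply/is_PpartitionP => x y lt_xy; rewrite !ffunE /=.
apply/bigmax_leqP => i Ii; rewrite ltn_ideal_height.
by apply: order_ideal_closed Ii; rewrite leEprod /= lexx ltW.
Qed.

Definition Ppartition_of_ideal I : Ppartition P k :=
  PPartition (ideal_height_Ppartition I).

Lemma Ppartition_of_idealK : cancel Ppartition_of_ideal ideal_of_Ppartition.
Proof.
move=> I; apply/val_inj/setP => -[x i].
by rewrite inE /= ffunE ltn_ideal_height.
Qed.

Lemma ideal_of_Ppartition_bij : bijective ideal_of_Ppartition.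
Proof.
have K := Ppartition_of_idealK.
by exists Ppartition_of_ideal => //; apply: inj_can_sym K ideal_of_Ppartition_inj.
Qed.

(** It suffices to test minimality against [(y, f y)], which forces [j = f y], and against [(z, j)]
    with [z < y], which forces [f y < f z]. *)
Lemma minimal_notin_subgraph f (y : P) (j : 'I_k) :
  (((y, j) : Q) \in minimal_elements (~: subgraph f)) =
  raisable f y && (j == f y :> nat).
Proof.
rewrite !inE /= -leqNgt; apply/andP/andP => [[le_fj /forall_inP jmin] | []].
  have jE : j = f y :> nat.
    apply/anti_leq; rewrite le_fj andbT leqNgt; apply/negP => lt_fj.
    have /jmin : ((y, Ordinal (ltn_trans lt_fj (ltn_ord j))) : Q) \in ~: subgraph f.
      by rewrite !inE /= ltnn.
    rewrite lt_neqAle leEprod leEord /= lexx ltnW // !andbT negbK.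
    by case/eqP=> /(congr1 val) /= ej; move: (lt_fj); rewrite ej ltnn.
  split; last exact/eqP.
  rewrite /raisable -jE ltn_ord; apply/forallP => z; apply/implyP => lt_zy.
  apply: contraTT isT => nlt.
  have /jmin : ((z, j) : Q) \in ~: subgraph f by rewrite !inE /=.
  rewrite lt_neqAle leEprod leEord /= leqnn ltW // !andbT negbK => /eqP[] ezy.
  by rewrite ezy ltxx in lt_zy.
case/andP=> lt_fk /forallP rf /eqP jE; rewrite jE; split=> //.
apply/forall_inP => -[z i]; rewrite !inE /= -leqNgt => le_fi.
apply/negP; rewrite lt_neqAle leEprod leEord /= => /and3P[neq le_zy le_ij].
move: le_zy; rewrite le_eqVlt => /predU1P[ezy | lt_zy].
  move: neq; rewrite ezy in le_fi *; case/eqP; congr (_, _); apply/val_inj.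
  by apply/anti_leq; rewrite le_ij /= jE.
by have := implyP (rf z) lt_zy; lia.
Qed.

Lemma rowmotion_ideal_of_Ppartition f (x : P) (i : 'I_k) :
  (((x, i) : Q) \in ideal_set (rowmotion (ideal_of_Ppartition f))) =
  [exists y, [&& x <= y, raisable f y & (i <= f y)%N]].
Proof.
rewrite inE; apply/exists_inP/existsP => [[[y j]] | [y /and3P[le_xy ry le_i]]].
  rewrite minimal_notin_subgraph leEprod leEord /=.
  move=> /andP[ry /eqP ej] /andP[le_xy le_ij].
  by exists y; rewrite le_xy ry -ej.
(* The bound included in [raisable] makes [f y] an index in ['I_k]. *)
have lt_fk : (f y < k)%N by case/andP: ry.
exists (y, Ordinal lt_fk); first by rewrite minimal_notin_subgraph ry /=.
by rewrite leEprod leEord /= le_xy.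
Qed.

Lemma ideal_of_whirling (s : seq P) f : linear_extension s ->
  ideal_of_Ppartition (whirling s f) = rowmotion (ideal_of_Ppartition f).
Proof.
move=> sP; apply/val_inj/setP => -[x i].
by rewrite rowmotion_ideal_of_Ppartition -(ltn_whirling _ _ _ sP) inE.
Qed.

End IdealOfPpartition.

Local Close Scope order_scope.

Theorem theorem2p12 (d : Order.disp_t) (P : finPOrderType d) (k : nat)
    (hk : (0 < k)%N) (s : seq P) (hs : linear_extension s) :
  exists phi : Ppartition P k -> order_ideal (P *p 'I_k)%type,
    bijective phi /\
    forall f : Ppartition P k, phi (whirling s f) = rowmotion (phi f).
Proof.
exists (@ideal_of_Ppartition _ P k); split; first exact: ideal_of_Ppartition_bij.
by move=> f; apply: ideal_of_whirling.
Qed.
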